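(* Let $\lambda>0$, $\alpha>0$, let $C\subset\mathbb{R}^d$ be convex and compact, let $q_\theta$ be the probability density on $\mathbb{R}^d$ of the output of a normalizing flow, and let $p(y|x)$ ($y\in\mathbb{R}^m$, $x\in\mathbb{R}^d$) be a likelihood. Suppose that $\sup_{x\in\mathbb{R}^d} q_\theta(x)<+\infty$ and that, for any $y\in\mathbb{R}^m$, $\sup_{x\in\mathbb{R}^d}p(y|x)<+\infty$ and $p(y|\cdot)\in \mathrm{C}^1(\mathbb{R}^d,(0,+\infty))$. Suppose moreover that there exist continuous functions $\Phi_1:\mathbb{R}^d\to[0,+\infty)$ and $\Phi_2:\mathbb{R}^m\to[0,+\infty)$ such that for any $x\in\mathbb{R}^d$ and $y_1,y_2\in\mathbb{R}^m$, $$\big|\log p(y_1|x)-\log p(y_2|x)\big|\leqslant\big(\Phi_1(x)+\Phi_2(y_1)+\Phi_2(y_2)\big)\|y_1-y_2\|,$$ and, for all $c_0>0$, $$\int_{\mathbb{R}^d}\big(1+\Phi_1(\tilde x)\big)\exp\left[c_0\,\Phi_1(\tilde x)-\iota_C^{(\lambda)}(\tilde x)\right]\mathrm{d}\tilde x<+\infty.$$ Then $y\mapsto\pi_{\lambda,y}$ is locally Lipschitz with respect to the total variation norm $\|\cdot\|_{\mathrm{TV}}$, i.e., for any compact set $K\subset\mathbb{R}^m$ there exists $M_K\geqslant 0$ such that for any $y_1,y_2\in K$, $$\|\pi_{\lambda,y_1}-\pi_{\lambda,y_2}\|_{\mathrm{TV}}\leqslant M_K\|y_1-y_2\|.$$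
   Context: $\Pi_C$ is the Euclidean projection onto the (nonempty) set $C$, $q_\theta^\alpha(x)=(q_\theta(x))^\alpha$, and $\iota_C^{(\lambda)}(x)=\frac{1}{2\lambda}\|x-\Pi_C(x)\|_2^2$. The measure $\pi_{\lambda,y}$ is the probability measure on $\mathbb{R}^d$ whose density with respect to Lebesgue measure is $$p_\lambda(x|y)=\frac{p(y|x)\,q_\theta^\alpha(x)\exp(-\iota_C^{(\lambda)}(x))}{\int_{\mathbb{R}^d}p(y|\tilde x)\,q_\theta^\alpha(\tilde x)\exp(-\iota_C^{(\lambda)}(\tilde x))\,\mathrm{d}\tilde x}.$$ For a finite signed measure $\xi$ on $\mathbb{R}^d$, $\|\xi\|_{\mathrm{TV}}=\sup\{|\int f\,\mathrm{d}\xi| : f \text{ measurable},\ \sup|f|\leqslant 1\}$. The output density of a normalizing flow $x=T(z)$, $z\sim q_z$, with $T:\mathbb{R}^d\to\mathbb{R}^d$ invertible and $T,T^{-1}$ differentiable, is $q_\theta(x)=q_z(T^{-1}(x))|\det J_{T^{-1}}(x)|$, where $J_{T^{-1}}$ is the Jacobian matrix of $T^{-1}$. *)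

(* Defs.v *)
From HB Require Import structures.
From mathcomp Require Import all_boot all_order all_algebra.
From mathcomp Require Import all_classical all_reals all_analysis.
From mathcomp Require Import measurable_realfun.

Set Implicit Arguments.
Unset Strict Implicit.
Unset Printing Implicit Defensive.

Import Order.TTheory GRing.Theory Num.Theory.
Import numFieldNormedType.Exports.

Local Open Scope classical_set_scope.
Local Open Scope ring_scope.

(* R^n is ['rV[R]_n].  The norm that the library puts on it is the sup norm;
   it is used only through its topology and its notion of differentiability,
   which are those of the Euclidean norm [enorm] below.  Measurable sets are
   the Borel sets. *)
HB.instance Definition _ (R : realType) (n : nat) :=
  Measurable.copy 'rV[R]_n (g_sigma_algebraType (@open 'rV[R]_n)).

Section borel_rV.
Context {R : realType}.

Lemma open_measurable_rV n (U : set 'rV[R]_n) : open U -> measurable U.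
Proof. by move=> oU; exact: sub_sigma_algebra. Qed.

Lemma continuous_measurable_rV n (f : 'rV[R]_n -> R) :
  continuous f -> measurable_fun [set: 'rV[R]_n] f.
Proof.
move=> /continuousP cf.
apply: (measurability _ (RGenOpens.measurableE R)) => _ [_ [a [b ->] <-]].
by rewrite setTI; apply: open_measurable_rV; apply: cf; exact: interval_open.
Qed.

Lemma rV_ballP n (c : 'rV[R]_n) (r : R) (v : 'rV[R]_n) : 0 < r ->
  ball c r v <-> forall i, ball (c ord0 i) r (v ord0 i).
Proof.
move=> r0; split; first by move=> bv i; exact: bv.2.
by move=> h; split => // i j; rewrite (ord1 i).
Qed.

Lemma measurable_fun_rV d (T : measurableType d) n (f : T -> 'rV[R]_n) :
  (forall i, measurable_fun [set: T] (fun x => f x ord0 i)) ->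
  measurable_fun [set: T] f.
Proof.
move=> mf.
apply: (@measurability _ _ _ 'rV[R]_n _ _ (@open 'rV[R]_n)) => // _ [U oU <-].
rewrite setTI.
pose I := ('rV[rat]_n * rat)%type.
pose box (cr : I) : set 'rV[R]_n := 
    ball (map_mx ratr cr.1 : 'rV[R]_n) (ratr cr.2 : R).
pose good (cr : I) := `[< 0 < cr.2 /\ box cr `<=` U >].
pose F (cr : I) : set T := if good cr then
  \bigcap_(i in [set: 'I_n])
    ((fun x => f x ord0 i) @^-1` ball (ratr (cr.1 ord0 i) : R) (ratr cr.2))
  else set0.
have boxP (cr : I) v : 0 < cr.2 ->
    box cr v <-> forall i, ball (ratr (cr.1 ord0 i) : R) (ratr cr.2) (v ord0 i).
  move=> r0; rewrite /box; split.
    by move=> /rV_ballP; rewrite ltr0q => /(_ r0) + i => /(_ i); rewrite mxE.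
  by move=> h; apply/rV_ballP; rewrite ?ltr0q// => i; rewrite mxE.
rewrite (_ : f @^-1` U = \bigcup_cr F cr).
  apply: countable_bigcupT_measurable; first exact: countableP.
  move=> cr.
  rewrite /F; case: ifP => // _; apply: fin_bigcap_measurable => // i _.
  rewrite -[X in measurable X]setTI; apply: mf => //; exact: measurable_ball.
apply/seteqP; split => [x /= Ufx|x [cr _]]; last first.
  rewrite /F; case: ifP => // /asboolP[r0 bU] h; apply/bU/boxP => // i.
  exact: (h i).
have /nbhs_ballP[e /= e0 eU] : nbhs (f x) U by exact: open_nbhs_nbhs.
have e20 : 0 < e / 2 by rewrite divr_gt0.
have [r] := rat_in_itvoo e20; rewrite inE /= => /itvP rP.
have r0 : 0 < r by rewrite -(ltr0q R) rP.
have re : ratr r < e / 2 :> R by rewrite rP.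
have rr0 : 0 < ratr r :> R by rewrite ltr0q.
have /choice[c cP] : forall i, exists q : rat,
    ball (f x ord0 i) (ratr r) (ratr q : R).
  move=> i; have : ball (f x ord0 i) (ratr r) `&` (@ratr R @` setT) !=set0.
    apply: dense_rat; last exact: ball_open.
    by exists (f x ord0 i); exact: ballxx.
  by move=> [z [bz [q _ qz]]]; exists q; rewrite qz.
have Fx : box (\row_i c i, r) (f x).
  by apply/boxP => //= i; rewrite mxE; exact: ball_sym.
exists (\row_i c i, r) => //; rewrite /F ifT.
  by move=> i _ /=; exact: ((boxP (_, _) _ r0).1 Fx i).
apply/asboolP; split => // v bv; apply: eU.
have ->: e = e / 2 + e / 2 by rewrite -splitr.
apply: le_ball (ball_triangle (ball_sym Fx) bv).
by rewrite lerD// ltW.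
Qed.


Lemma measurable_coord_rV n (i : 'I_n) :
  measurable_fun [set: 'rV[R]_n] (fun v => v ord0 i).
Proof. by apply: continuous_measurable_rV; exact: coord_continuous. Qed.

Definition rV_cons n (z : R * 'rV[R]_n) : 'rV[R]_n.+1 :=
  \row_i oapp (z.2 ord0) z.1 (unlift ord0 i).

Lemma rV_cons0 n (z : R * 'rV[R]_n) : rV_cons z ord0 ord0 = z.1.
Proof. by rewrite mxE unlift_none. Qed.

Lemma rV_consS n (z : R * 'rV[R]_n) (i : 'I_n) :
  rV_cons z ord0 (lift ord0 i) = z.2 ord0 i.
Proof. by rewrite mxE liftK. Qed.

Lemma measurable_rV_cons n : measurable_fun [set: R * 'rV[R]_n] (@rV_cons n).
Proof.
apply: measurable_fun_rV => i; have [j ->|->] := unliftP ord0 i.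
  apply: (eq_measurable_fun (fun z : R * 'rV[R]_n => z.2 ord0 j)) => [z _|].
    by rewrite rV_consS.
  exact: (measurableT_comp (measurable_coord_rV j)) measurable_snd.
apply: (eq_measurable_fun (fun z : R * 'rV[R]_n => z.1)) => [z _|].
  by rewrite rV_cons0.
exact: measurable_fst.
Qed.

Let rV_uncons n (v : 'rV[R]_n.+1) : R * 'rV[R]_n :=
  (v ord0 ord0, \row_i v ord0 (lift ord0 i)).

Let rV_consK n : cancel (@rV_cons n) (@rV_uncons n).
Proof.
move=> [x v]; rewrite /rV_uncons rV_cons0; congr pair.
by apply/rowP => i; rewrite mxE rV_consS.
Qed.

Let measurable_rV_uncons n : measurable_fun [set: 'rV[R]_n.+1] (@rV_uncons n).
Proof.
apply/measurable_fun_pairP; split; first exact: measurable_coord_rV.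
apply: measurable_fun_rV => i.
apply: (eq_measurable_fun (fun v : 'rV[R]_n.+1 => v ord0 (lift ord0 i))).
  by move=> v _; rewrite /= mxE.
exact: measurable_coord_rV.
Qed.

Section lebesgue_step.
Local Open Scope ereal_scope.
Variables (n : nat) (mu : {sigma_finite_measure set 'rV[R]_n -> \bar R}).

Definition lebesgue_rV_step : set 'rV[R]_n.+1 -> \bar R :=
  pushforward (@lebesgue_measure R \x mu) (@rV_cons n).

Let step0 : lebesgue_rV_step set0 = 0.
Proof. by rewrite /lebesgue_rV_step /pushforward preimage_set0 measure0. Qed.

Let step_ge0 A : 0 <= lebesgue_rV_step A.
Proof. by rewrite /lebesgue_rV_step /pushforward; exact: measure_ge0. Qed.

Let mcons A : measurable A -> measurable (@rV_cons n @^-1` A).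
Proof.
by move=> mA; rewrite -[X in measurable X]setTI; exact: measurable_rV_cons.
Qed.

Let step_sigma_additive : semi_sigma_additive lebesgue_rV_step.
Proof.
move=> F mF tF mUF; rewrite /lebesgue_rV_step /pushforward preimage_bigcup.
apply: measure_semi_sigma_additive.
- by move=> k; exact: mcons.
- apply/trivIsetP => /= i j _ _ ij; rewrite -preimage_setI.
  by move/trivIsetP : tF => /(_ _ _ _ _ ij) ->//; rewrite preimage_set0.
- by rewrite -preimage_bigcup; exact: mcons.
Qed.

HB.instance Definition _ := isMeasure.Build _ _ _ lebesgue_rV_step
  step0 step_ge0 step_sigma_additive.

Let step_sigma_finite : sigma_finite setT lebesgue_rV_step.
Proof.
have /sigma_finiteP[F [FT ndF Foo]] := sigma_finiteT (@lebesgue_measure R).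
have /sigma_finiteP[G [GT ndG Goo]] := sigma_finiteT mu.
exists (fun k => @rV_uncons n @^-1` (F k `*` G k)).
  apply/esym; rewrite -subTset => v _.
  have [k _ Fk] : (\bigcup_k F k) (rV_uncons v).1 by rewrite -FT.
  have [l _ Gl] : (\bigcup_k G k) (rV_uncons v).2 by rewrite -GT.
  exists (maxn k l) => //; split.
    by move: Fk; exact/subsetPset/ndF/leq_maxl.
  by move: Gl; exact/subsetPset/ndG/leq_maxr.
move=> k; have [mF F_oo] := Foo k; have [mG G_oo] := Goo k; split.
  rewrite -[X in measurable X]setTI; apply: measurable_rV_uncons => //.
  exact: measurableX.
rewrite /lebesgue_rV_step /pushforward -comp_preimage.
rewrite (_ : _ \o _ = id); last by apply/funext => z /=; rewrite rV_consK.
by rewrite preimage_id product_measure1E// lte_mul_pinfty// ge0_fin_numE.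
Qed.

HB.instance Definition _ := @Measure_isSigmaFinite.Build _ _ _ lebesgue_rV_step
  step_sigma_finite.

End lebesgue_step.

(* The [n]-dimensional Lebesgue measure, as an iterated product; R^0 is a
   single point, of mass 1. *)
Fixpoint lebesgue_rV n : {sigma_finite_measure set 'rV[R]_n -> \bar R} :=
  if n is n'.+1 then lebesgue_rV_step (lebesgue_rV n') else dirac (0 : 'rV[R]_0).

Lemma lebesgue_rV_box n (a b : 'rV[R]_n) :
  (forall i, a ord0 i <= b ord0 i) ->
  lebesgue_rV n [set v | forall i, v ord0 i \in `[a ord0 i, b ord0 i]] =
  (\prod_(i < n) (b ord0 i - a ord0 i))%:E.
Proof.
elim: n a b => [|n IH] a b ab.
  rewrite big_ord0 /= diracE mem_set//.
  by case.
rewrite big_ord_recl /= /lebesgue_rV_step /pushforward.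
pose tl (v : 'rV[R]_n.+1) := \row_i v ord0 (lift ord0 i).
rewrite [X in product_measure1 _ _ X](_ : _ = `[a ord0 ord0, b ord0 ord0] `*`
    [set v : 'rV[R]_n | forall i, v ord0 i \in `[tl a ord0 i, tl b ord0 i]]).
  rewrite product_measure1E//; last first.
    rewrite (_ : mkset _ = \bigcap_(i in [set: 'I_n])
       (fun v : 'rV[R]_n => v ord0 i) @^-1` `[tl a ord0 i, tl b ord0 i]).
      apply: fin_bigcap_measurable => // i _.
      by rewrite -[X in measurable X]setTI; exact: measurable_coord_rV.
    by apply/seteqP; split=> v /= h i => [_|]; apply: h.
  rewrite IH; last by move=> i; rewrite !mxE.
  rewrite EFinM /=.
  rewrite lebesgue_measure_itv /= lte_fin; congr (_ * _)%E.
    case: ltP => //; rewrite le_eqVlt ltNge ab orbF => /eqP ->.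
    by rewrite subrr.
  by congr EFin; apply: eq_bigr => i _; rewrite !mxE.
apply/seteqP; split=> [[x v] /= h|[x v] /= [hx hv] i].
  split; first by have := h ord0; rewrite rV_cons0.
  by move=> i; have := h (lift ord0 i); rewrite rV_consS !mxE.
have [j ->|->] := unliftP ord0 i; last by rewrite rV_cons0.
by have := hv j; rewrite rV_consS !mxE.
Qed.

End borel_rV.
Arguments lebesgue_rV : clear implicits.

Section euclidean.
Context {R : realType}.

Definition enorm n (v : 'rV[R]_n) : R := Num.sqrt (\sum_i v ord0 i ^+ 2).

(* Some minimizer of the Euclidean distance; it exists and is unique when [C]
   is nonempty, closed and convex. *)
Definition eproj n (C : set 'rV[R]_n) (x : 'rV[R]_n) : 'rV[R]_n :=
  xget 0 [set z | C z /\ forall w, C w -> enorm (x - z) <= enorm (x - w)].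

Definition iota_smooth n (lambda : R) (C : set 'rV[R]_n) (x : 'rV[R]_n) : R :=
  (2 * lambda)^-1 * enorm (x - eproj C x) ^+ 2.

Definition is_C1 n (f : 'rV[R]_n -> R) :=
  (forall x, differentiable f x) /\
  (forall v, continuous (fun x => 'd f x v)).

End euclidean.

Section charge_integral.
Context {R : realType} d (T : measurableType d).
Local Open Scope ereal_scope.

(* Integral against the Jordan decomposition; it does not depend on the
   Hahn decomposition that is picked. *)
Definition charge_integral (xi : {charge set T -> \bar R}) (f : T -> \bar R) :=
  let hP := cid (Hahn_decomposition xi) in
  let hN := cid (projT2 hP) in
  \int[jordan_pos (projT2 hN)]_x f x - \int[jordan_neg (projT2 hN)]_x f x.

Definition tv_norm (xi : {charge set T -> \bar R}) : \bar R :=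
  ereal_sup [set `|charge_integral xi (EFin \o f)| | f in
    [set f : T -> R | measurable_fun setT f /\ forall x, (`|f x| <= 1)%R]].

Definition charge_sub (mu nu : {finite_measure set T -> \bar R}) :
    {charge set T -> \bar R} :=
  cadd (charge_of_finite_measure mu) (copp (charge_of_finite_measure nu)).

End charge_integral.

Section posterior.
Context {R : realType}.
Local Notation leb := (lebesgue_rV R).

Definition is_density n (q : 'rV[R]_n -> R) :=
  [/\ measurable_fun setT q, forall x, 0 <= q x &
      (\int[leb n]_x (q x)%:E = 1)%E].

(* [jacobian] acts on row vectors, hence is the transpose of the usual Jacobian
   matrix; the determinant is the same. *)
Definition is_flow_density n (q : 'rV[R]_n -> R) :=
  is_density q /\
  exists (qz : 'rV[R]_n -> R) (T Tinv : 'rV[R]_n -> 'rV[R]_n),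
    [/\ is_density qz, cancel T Tinv /\ cancel Tinv T,
        forall z, differentiable T z, forall x, differentiable Tinv x &
        forall x, q x = qz (Tinv x) * `|\det (jacobian Tinv x)|].

(* [p y x] stands for p(y|x). *)
Definition posterior_weight d m (lambda alpha : R) (C : set 'rV[R]_d)
    (q : 'rV[R]_d -> R) (p : 'rV[R]_m -> 'rV[R]_d -> R)
    (y : 'rV[R]_m) (x : 'rV[R]_d) : R :=
  p y x * (q x `^ alpha) * expR (- iota_smooth lambda C x).

Definition posterior_density d m (lambda alpha : R) (C : set 'rV[R]_d)
    (q : 'rV[R]_d -> R) (p : 'rV[R]_m -> 'rV[R]_d -> R)
    (y : 'rV[R]_m) (x : 'rV[R]_d) : R :=
  posterior_weight lambda alpha C q p y x /
  (\int[leb d]_t posterior_weight lambda alpha C q p y t).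

Definition has_density n (mu : probability 'rV[R]_n R) (f : 'rV[R]_n -> R) :=
  forall A, measurable A -> mu A = (\int[leb n]_(x in A) (f x)%:E)%E.

Definition locally_lipschitz_tv d m (post : 'rV[R]_m -> probability 'rV[R]_d R) :=
  forall K : set 'rV[R]_m, compact K ->
    exists2 M : R, 0 <= M & forall y1 y2, K y1 -> K y2 ->
      (tv_norm (charge_sub (post y1) (post y2)) <= (M * enorm (y1 - y2))%:E)%E.

End posterior.

(* Main.v *)
Require Import Defs.
From HB Require Import structures.
From mathcomp Require Import all_boot all_order all_algebra.
From mathcomp Require Import all_classical all_reals all_analysis.
From mathcomp Require Import measurable_realfun ring lra.

Import Order.TTheory GRing.Theory Num.Theory.
Import numFieldNormedType.Exports.

Local Open Scope classical_set_scope.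
Local Open Scope ring_scope.

(** The posterior weights at two observations [y1], [y2] differ only through
the likelihood, which is log-Lipschitz in the observation.  On a compact set [K]
the Lipschitz constant at [x] is at most [Phi1 x] plus a constant, and the
distance to a fixed [y0] in [K] is at most some [D], so
- comparing with the bounded function [p y0] from above ([ler_expR_dist_ln])
  gives [p y x <= B * expR (c * Phi1 x)] for all [y] in [K];
- the elementary bound of [ler_dist_ln] turns log-Lipschitz into Lipschitz at
  the cost of this factor, so the weights differ pointwise by at most a multiple
  of [enorm (y1 - y2)] times the function
  [(1 + Phi1 x) * expR (c * Phi1 x - iota_smooth lambda C x)], integrable by
  assumption.
Hence the unnormalized posteriors are Lipschitz in L1 on [K].

Normalizing costs a factor [2 / Z y1], where [Z y1] is the normalizing constant
([L1_dist_normalize]), so [Z] must stay away from 0 on [K].  Comparing with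
[p y0] from below bounds every weight on [K] by one function [h]; its integral
is positive because [h] vanishes only where [q] does and [q] has integral 1
([Rintegral_gt0_density]).

It remains to know that the total variation distance is at most the L1 distance
of the densities ([tv_norm_le_L1]): the Jordan parts of the difference live on
the two pieces of a Hahn decomposition, and on each piece the mass is at most
the integral of the absolute difference.

Measurability of the smoothed indicator needs an argument, since the projection
is given only as some minimizer: a sublevel set of the distance to [C] is a
union of open sets, one for each point of [C] ([measurable_dist_eproj]). *)

(** * Logarithmic comparison *)

(** The mean value inequality for the exponential between [ln a] and [ln b], where
its derivative is at most [c]; it reduces to [1 + t <= expR t] at
[t = ln b - ln a]. *)
Lemma ler_dist_ln {R : realType} (a b c : R) :
  0 < a -> 0 < b -> a <= c -> b <= c -> `|a - b| <= c * `|ln a - ln b|.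
Proof.
wlog ba : a b / b <= a.
  move=> H a0 b0 ac bc; have [ba|/ltW ab] := leP b a; first exact: H.
  by rewrite distrC (distrC (ln a)); exact: H.
move=> a0 b0 ac bc; rewrite !ger0_norm ?subr_ge0 ?ler_ln ?posrE//.
have : 1 + (ln b - ln a) <= b / a.
  apply: le_trans (expR_ge1Dx _) _.
  by rewrite expRD expRN !lnK ?posrE.
rewrite ler_pdivlMr// => /[dup] H.
have lba : 0 <= ln a - ln b by rewrite subr_ge0 ler_ln ?posrE.
by nra.
Qed.

Lemma ler_expR_dist_ln {R : realType} (a b t : R) :
  0 < a -> 0 < b -> `|ln a - ln b| <= t -> a <= b * expR t.
Proof.
move=> a0 b0 h; rewrite -[leLHS](@lnK _ a) ?posrE//.
rewrite -[X in X * _](@lnK _ b) ?posrE// -expRD ler_expR -lerBlDl.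
exact: le_trans (ler_norm _) h.
Qed.

(** * Distance to a compact set *)

Lemma enorm_ge0 {R : realType} {n : nat} (v : 'rV[R]_n) : 0 <= enorm v.
Proof. exact: sqrtr_ge0. Qed.

Lemma continuous_enormB {R : realType} {n : nat} (c : 'rV[R]_n) :
  continuous (fun x : 'rV[R]_n => enorm (x - c)).
Proof.
have csum : continuous (fun x : 'rV[R]_n => \sum_i (x - c) ord0 i ^+ 2).
  apply: continuous_big => [|i _ x]; first exact: add_continuous.
  have ci : {for x, continuous (fun x : 'rV[R]_n => (x - c) ord0 i)}.
    rewrite (_ : (fun x => _) = (fun x : 'rV[R]_n => x ord0 i - c ord0 i)).
      apply: continuousB; [exact: coord_continuous|exact: cst_continuous].
    by apply/funext => v; rewrite !mxE.
  exact: (@continuous_comp _ _ _ (fun x : 'rV[R]_n => (x - c) ord0 i)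
    (fun t : R => t ^+ 2) x ci (@exprn_continuous _ 2 _)).
move=> x; apply: (@continuous_comp _ _ _
  (fun x : 'rV[R]_n => \sum_i (x - c) ord0 i ^+ 2) Num.sqrt); first exact: csum.
exact: sqrt_continuous.
Qed.

Lemma compact_continuous_bounded {R : realType} {n : nat} (f : 'rV[R]_n -> R)
    (K : set 'rV[R]_n) : K !=set0 -> compact K -> continuous f ->
  exists b, forall x, K x -> f x <= b.
Proof.
move=> K0 cK cf.
have [|c _ h] := @EVT_max_rV R n f K K0 cK; first exact: continuous_subspaceT.
by exists (f c) => x Kx; apply: h; exact/mem_set.
Qed.

Lemma enormBC {R : realType} {n : nat} (v w : 'rV[R]_n) :
  enorm (v - w) = enorm (w - v).
Proof.
rewrite /enorm; congr Num.sqrt; apply: eq_bigr => i _.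
by rewrite -opprB mxE sqrrN.
Qed.

Lemma eproj_min {R : realType} {n : nat} (C : set 'rV[R]_n) (x : 'rV[R]_n) :
  C !=set0 -> compact C ->
  C (eproj C x) /\ forall w, C w -> enorm (x - eproj C x) <= enorm (x - w).
Proof.
move=> C0 cC.
have [|c Cc h] := @EVT_min_rV R n (fun w => enorm (w - x)) C C0 cC.
  by apply: continuous_subspaceT; exact: continuous_enormB.
rewrite /eproj; case: xgetP => [z -> //|/(_ c)[]]; split; first exact/set_mem.
by move=> w Cw; rewrite enormBC (enormBC x w); exact/h/mem_set.
Qed.

(** The minimum over [C] is below [a] iff some point of [C] is at distance less
than [a], so the sublevel sets are open whichever minimizer [eproj C] picks. *)
Lemma measurable_dist_eproj {R : realType} {n : nat} (C : set 'rV[R]_n) :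
  C !=set0 -> compact C ->
  measurable_fun setT (fun x : 'rV[R]_n => enorm (x - eproj C x)).
Proof.
move=> C0 cC.
apply: (measurability _ (RGenInftyO.measurableE R)) => _ [_ [a ->] <-].
rewrite setTI; apply: open_measurable_rV.
rewrite [X in open X](_ : _ =
    \bigcup_(w in C) ((fun x : 'rV[R]_n => enorm (x - w)) @^-1` `]-oo, a[)).
  apply: bigcup_open => w _; have /continuousP := @continuous_enormB R n w.
  by apply; exact: interval_open.
apply/seteqP; split=> x /=.
  by move=> h; exists (eproj C x) => //; exact: (eproj_min _ _ C0 cC).1.
move=> [w Cw] /=; rewrite !in_itv /=; apply: le_lt_trans.
exact: (eproj_min C x C0 cC).2.
Qed.

Lemma measurable_iota_smooth {R : realType} {n : nat} (lambda : R)
    (C : set 'rV[R]_n) : C !=set0 -> compact C ->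
  measurable_fun setT (iota_smooth lambda C).
Proof.
move=> C0 cC; apply: measurable_funM; first exact: measurable_cst.
by apply: measurable_funX; exact: measurable_dist_eproj.
Qed.

(** * Densities and total variation *)

Lemma exists_probability_density {R : realType} {d : measure_display}
    {T : measurableType d} (mu : {measure set T -> \bar R}) (f : T -> R) :
  measurable_fun setT f -> (forall x, 0 <= f x) ->
  (\int[mu]_x (f x)%:E = 1)%E ->
  exists P : probability T R,
    forall A, measurable A -> P A = (\int[mu]_(x in A) (f x)%:E)%E.
Proof.
move=> mf f0 f1; pose nu A := (\int[mu]_(x in A) (f x)%:E)%E.
have nu0 : nu set0 = 0%E by exact: integral_set0.
have nu_ge0 A : (0 <= nu A)%E.
  by apply: integral_ge0 => x _; rewrite lee_fin.
have nu_sigma : semi_sigma_additive nu.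
  move=> F mF tF mUF; rewrite /nu ge0_integral_bigcup//=.
  - by apply: is_cvg_ereal_nneg_natsum_cond => n _ _; exact: nu_ge0.
  - by apply/measurable_EFinP; exact: measurable_funTS.
  - by move=> x _; rewrite lee_fin.
pose mM := isMeasure.Build _ _ _ nu nu0 nu_ge0 nu_sigma.
pose M : {measure set T -> \bar R} := HB.pack nu mM.
pose mP := @Measure_isProbability.Build _ _ R M f1.
pose P : probability T R := HB.pack nu mM mP.
by exists P.
Qed.

(** A test function bounded by 1 integrates, against each Jordan part, to at most
the mass of that part, and the two masses are the charges, up to sign, of
complementary sets. *)
Lemma tv_norm_le_L1 {R : realType} {d : measure_display}
    {T : measurableType d} (mu : {measure set T -> \bar R}) (f g : T -> R)
    (P Q : probability T R) :
  mu.-integrable setT (EFin \o f) -> mu.-integrable setT (EFin \o g) ->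
  (forall A, measurable A -> P A = (\int[mu]_(x in A) (f x)%:E)%E) ->
  (forall A, measurable A -> Q A = (\int[mu]_(x in A) (g x)%:E)%E) ->
  (tv_norm (charge_sub P Q) <= \int[mu]_x `|f x - g x|%:E)%E.
Proof.
move=> intf intg Pf Qg.
have intfg : mu.-integrable setT (EFin \o (fun x => f x - g x)).
  exact: (integrableB measurableT intf intg).
have mfg := measurable_int _ intfg.
have subE A : measurable A ->
    charge_sub P Q A = (\int[mu]_(x in A) (f x - g x)%:E)%E.
  move=> mA; transitivity (P A - Q A)%E => //; rewrite Pf// Qg//.
  by rewrite -integralB//; exact: integrableS intf || exact: integrableS intg.
have le_sub A : measurable A ->
    (`|charge_sub P Q A| <= \int[mu]_(x in A) `|f x - g x|%:E)%E.
  move=> mA; rewrite subE//.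
  apply: le_trans (le_abse_integral _ _ _) _ => //.
  exact: measurable_funS mfg.
apply: ge_ereal_sup => _ [h [mh h1] <-]; rewrite /charge_integral.
case: cid => A hA; case: cid => B /= hAB.
have [[mA _] [mB _] ABT AB0] := hAB.
have le_mass (nu : {measure set T -> \bar R}) :
    (`|\int[nu]_x (h x)%:E| <= nu setT)%E.
  apply: le_trans (le_abse_integral _ _ _) _ => //.
    exact/measurable_EFinP.
  rewrite -[leRHS]mul1e -integral_cst//; apply: ge0_le_integral => //.
    by apply/measurable_EFinP; exact: measurableT_comp mh.
  by move=> x _; rewrite lee_fin.
apply: le_trans (lee_abs_sub _ _) _.
apply: le_trans (leeD (le_mass _) (le_mass _)) _.
rewrite [X in (X + _)%E]jordan_posE [X in (_ + X)%E]jordan_negE.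
rewrite -ABT ge0_integral_setU//; last 2 first.
- rewrite ABT; apply/measurable_EFinP; apply: measurableT_comp => //.
  exact/measurable_EFinP/mfg.
- by rewrite disj_set2E AB0.
rewrite cjordan_posE cjordan_negE ABT /crestr0 /= mem_set// /crestr !setTI.
apply: leeD; first exact: le_trans (lee_abs _) (le_sub _ mA).
by apply: le_trans (lee_abs _) _; rewrite abseN; exact: le_sub.
Qed.

Lemma integral_normalize {R : realType} {d : measure_display}
    {T : measurableType d} (mu : {measure set T -> \bar R}) (w : T -> R) :
  mu.-integrable setT (EFin \o w) -> 0 < \int[mu]_x w x ->
  (\int[mu]_x (w x / \int[mu]_t w t)%:E = 1)%E.
Proof.
move=> intw w0.
under eq_integral do rewrite mulrC EFinM.
rewrite integralZl// -[X in (_ * X)%E]fineK; last exact: integrable_fin_num.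
by rewrite -EFinM mulVf// gt_eqF.
Qed.

(** Pass from [v / a] to [w / b] through [w / a], where [a] and [b] are the two
integrals: the first step costs the L1 distance over [a], the second costs
[|1 / a - 1 / b| * b = |a - b| / a], which is no larger. *)
Lemma L1_dist_normalize {R : realType} {d : measure_display}
    {T : measurableType d} (mu : {measure set T -> \bar R}) (v w : T -> R) :
  mu.-integrable setT (EFin \o v) -> mu.-integrable setT (EFin \o w) ->
  (forall x, 0 <= w x) -> 0 < \int[mu]_x v x -> 0 < \int[mu]_x w x ->
  \int[mu]_x `|v x / (\int[mu]_t v t) - w x / (\int[mu]_t w t)| <=
    2 / (\int[mu]_t v t) * \int[mu]_x `|v x - w x|.
Proof.
move=> intv intw w_ge0; set a := \int[mu]_x v x; set b := \int[mu]_x w x.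
move=> a0 b0; pose D := \int[mu]_x `|v x - w x|.
have intvw : mu.-integrable setT (EFin \o (fun x => v x - w x)).
  exact: (integrableB measurableT intv intw).
have intD : mu.-integrable setT (EFin \o (fun x => `|v x - w x|)).
  exact: integrable_norm.
have intZ (k : R) (u : T -> R) : mu.-integrable setT (EFin \o u) ->
    mu.-integrable setT (EFin \o (fun x => k * u x)).
  by move=> iu; exact: (integrableZl measurableT k iu).
have abD : `|a - b| <= D.
  by rewrite -RintegralB//; exact: le_normr_Rintegral.
apply: (@le_trans _ _ (\int[mu]_x (a^-1 * `|v x - w x| + `|a^-1 - b^-1| * w x))).
  apply: le_Rintegral => //.
  - apply: (@integrable_norm _ _ _ _ _ (fun x => v x / a - w x / b)).
    apply: (@integrableB _ _ _ _ _ _ (EFin \o (fun x => v x / a))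
      (EFin \o (fun x => w x / b))) => //.
      by under eq_fun do rewrite mulrC; exact: intZ.
    by under eq_fun do rewrite mulrC; exact: intZ.
  - apply: (@integrableD _ _ _ _ _ _ (EFin \o (fun x => a^-1 * `|v x - w x|))
      (EFin \o (fun x => `|a^-1 - b^-1| * w x))) => //; exact: intZ.
  - move=> x _.
    rewrite (_ : _ - _ = a^-1 * (v x - w x) + (a^-1 - b^-1) * w x); last by ring.
    apply: le_trans (ler_normD _ _) _.
    by rewrite !normrM (ger0_norm (w_ge0 x)) ger0_norm// invr_ge0 ltW.
rewrite RintegralD//; [|exact: intZ..].
rewrite !RintegralZl// -/D -/b.
have -> : `|a^-1 - b^-1| * b = a^-1 * `|a - b|.
  rewrite (_ : a^-1 - b^-1 = (a * b)^-1 * (b - a)); last first.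
    by field; rewrite !gt_eqF.
  rewrite normrM (distrC b) ger0_norm ?invr_ge0 ?mulr_ge0 ?ltW//.
  by field; rewrite !gt_eqF.
rewrite (_ : 2 / a * D = a^-1 * D + a^-1 * D); last by ring.
by rewrite lerD2l ler_pM2l// invr_gt0.
Qed.

(** If the integral of [w] vanished, then [w] would vanish almost everywhere, and
with it [q], which has integral 1.  This is the source of positivity for the
normalizing constants: [q] may vanish on large sets. *)
Lemma Rintegral_gt0_density {R : realType} {d : measure_display}
    {T : measurableType d} (mu : {measure set T -> \bar R}) (q w : T -> R) :
  measurable_fun setT q -> (\int[mu]_x (q x)%:E = 1)%E ->
  mu.-integrable setT (EFin \o w) -> (forall x, 0 <= w x) ->
  (forall x, w x = 0 -> q x = 0) -> 0 < \int[mu]_x w x.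
Proof.
move=> mq q1 intw w_ge0 w0q0.
rewrite lt_neqAle Rintegral_ge0 ?andbT//; apply/eqP => /esym w0.
have mw := measurable_int _ intw.
have : (\int[mu]_x `|(w x)%:E| = 0)%E.
  under eq_integral do rewrite gee0_abs ?lee_fin//.
  rewrite -[LHS]fineK; last exact: integrable_fin_num intw.
  by rewrite -/(Rintegral _ _ _) w0.
move=> /(ae_eq_integral_abs _ measurableT mw) aew.
have : (\int[mu]_x (q x)%:E = \int[mu]_x 0%:E)%E.
  apply: ae_eq_integral => //; first exact/measurable_EFinP.
  apply: filterS aew => x /= + _ => /(_ I) [wx0].
  by rewrite w0q0.
rewrite q1 integral0 => /eqP.
by rewrite onee_eq0.
Qed.

(** * The posterior *)

Theorem proposition3p5 (R : realType) (d m : nat) (lambda alpha : R)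
    (C : set 'rV[R]_d) (q : 'rV[R]_d -> R) (p : 'rV[R]_m -> 'rV[R]_d -> R)
    (lambda_gt0 : 0 < lambda) (alpha_gt0 : 0 < alpha)
    (C_nonempty : C !=set0) (C_convex : convex_set C) (C_compact : compact C)
    (q_flow : is_flow_density q) (q_bounded : has_ubound (range q))
    (p_bounded : forall y, has_ubound (range (p y)))
    (p_C1 : forall y, is_C1 (p y))
    (p_gt0 : forall y x, 0 < p y x)
    (p_loglip : exists (Phi1 : 'rV[R]_d -> R) (Phi2 : 'rV[R]_m -> R),
      [/\ continuous Phi1 /\ (forall x, 0 <= Phi1 x),
          continuous Phi2 /\ (forall y, 0 <= Phi2 y),
          forall x y1 y2,
            `|ln (p y1 x) - ln (p y2 x)| <=
              (Phi1 x + Phi2 y1 + Phi2 y2) * enorm (y1 - y2) &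
          forall c0, 0 < c0 ->
            (\int[lebesgue_rV R d]_x
               ((1 + Phi1 x) *
                expR (c0 * Phi1 x - iota_smooth lambda C x))%:E < +oo)%E]) :
  exists2 post : 'rV[R]_m -> probability 'rV[R]_d R,
    (forall y, has_density (post y) (posterior_density lambda alpha C q p y)) &
    locally_lipschitz_tv post.
Proof.
have [[mq q_ge0 q1] _] := q_flow.
have [Phi1 [Phi2 [[cPhi1 Phi1_ge0] [cPhi2 Phi2_ge0] loglip G_fin]]] := p_loglip.
pose leb := lebesgue_rV R d; pose io := iota_smooth lambda C.
pose w := posterior_weight lambda alpha C q p.
pose Z y := \int[leb]_x w y x.
have mio : measurable_fun setT io by exact: measurable_iota_smooth.
have mPhi1 := continuous_measurable_rV cPhi1.
have p_ge0 y x : 0 <= p y x by exact: ltW.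
have mp y : measurable_fun setT (p y).
  apply: continuous_measurable_rV => x; apply: differentiable_continuous.
  exact: (p_C1 y).1.
have mqa : measurable_fun setT (fun x => q x `^ alpha).
  exact: (measurableT_comp (measurable_powR alpha) mq).
have meio : measurable_fun setT (fun x => expR (- io x)).
  by apply: measurableT_comp => //; apply: measurableT_comp => //.
have [Q Q_ge0 qaQ] : exists2 Q, 0 <= Q & forall x, q x `^ alpha <= Q.
  have [b qb] := q_bounded; exists (b `^ alpha); first exact: powR_ge0.
  move=> x; have qxb : q x <= b by apply: qb; exists x.
  by apply: ge0_ler_powR; rewrite ?nnegrE ?(le_trans _ qxb)// ltW.
pose G c x := (1 + Phi1 x) * expR (c * Phi1 x - io x).
have G_ge0 c x : 0 <= G c x by rewrite mulr_ge0 ?expR_ge0// addr_ge0.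
have intG c : 0 < c -> leb.-integrable setT (EFin \o G c).
  move=> c0; apply/integrableP; split.
    apply/measurable_EFinP; apply: measurable_funM.
      exact: measurable_funD.
    apply: measurableT_comp => //; apply: measurable_funB => //.
    exact: measurable_funM.
  under eq_integral do rewrite gee0_abs ?lee_fin//.
  exact: G_fin.
have G_ge_expR c x : expR (c * Phi1 x - io x) <= G c x.
  by rewrite ler_peMl ?expR_ge0// lerDl.
have w_gt0 y x : 0 < q x -> 0 < w y x.
  by move=> qx; rewrite !mulr_gt0 ?powR_gt0 ?expR_gt0.
have w_ge0 y x : 0 <= w y x.
  by rewrite !mulr_ge0 ?powR_ge0 ?expR_ge0.
have mw y : measurable_fun setT (w y).
  by apply: measurable_funM => //; exact: measurable_funM.
have intw y : leb.-integrable setT (EFin \o w y).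
  have [b pb] := p_bounded y.
  have pxb x : p y x <= b by apply: pb; exists x.
  have iG := integrableZl measurableT (b * Q) (intG 1 ltr01).
  apply: le_integrable iG => //; first exact/measurable_EFinP.
  move=> x _; rewrite /= lee_fin ger0_norm//; apply: le_trans (ler_norm _).
  rewrite /w /posterior_weight.
  apply: ler_pM; rewrite ?expR_ge0 ?mulr_ge0 ?powR_ge0//.
    by apply: ler_pM; rewrite ?powR_ge0.
  apply: le_trans (G_ge_expR _ _).
  by rewrite ler_expR lerDr mul1r.
have Z_gt0 y : 0 < Z y.
  apply: (Rintegral_gt0_density leb q) => // x wx0; apply/eqP.
  by rewrite eq_le q_ge0 andbT leNgt; apply/negP => /(w_gt0 y); rewrite wx0 ltxx.
pose f := posterior_density lambda alpha C q p.
have fE y x : f y x = w y x / Z y by [].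
have intf y : leb.-integrable setT (EFin \o f y).
  have := integrableZl measurableT (Z y)^-1 (intw y).
  by under eq_fun do rewrite -EFinM mulrC.
have [post postP] : {post : 'rV[R]_m -> probability 'rV[R]_d R &
    forall y A, measurable A -> post y A = (\int[leb]_(x in A) (f y x)%:E)%E}.
  apply: (@choice _ _ (fun y (P : probability 'rV[R]_d R) =>
    forall A, measurable A -> P A = (\int[leb]_(x in A) (f y x)%:E)%E)) => y.
  apply: exists_probability_density; last 1 first.
    exact: (integral_normalize leb (w y) (intw y) (Z_gt0 y)).
  - by apply/measurable_EFinP; exact: measurable_int _ (intf y).
  - by move=> x; rewrite fE divr_ge0// ltW.
exists post; first exact: postP.
move=> K cK.
have [->|/set0P K0] := eqVneq K set0; first by exists 0.
have [y0 Ky0] := K0.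
have [D distD] := compact_continuous_bounded _ K K0 cK (continuous_enormB y0).
have [S PhiS] := compact_continuous_bounded _ K K0 cK cPhi2.
have [b pb] := p_bounded y0.
have D_ge0 : 0 <= D by exact: le_trans (enorm_ge0 _) (distD _ Ky0).
have S_ge0 : 0 <= S by exact: le_trans (Phi2_ge0 _) (PhiS _ Ky0).
have p0b x : p y0 x <= b by apply: pb; exists x.
have b_ge0 : 0 <= b by exact: le_trans (ltW (p_gt0 y0 0)) (p0b 0).
(* On [K], [p y x] and [p y0 x] differ by a factor of at most [expR (e x)]. *)
pose e x := (Phi1 x + 2 * S) * D.
have log_e y x : K y -> `|ln (p y x) - ln (p y0 x)| <= e x.
  move=> Ky; apply: le_trans (loglip x y y0) _.
  apply: ler_pM; rewrite ?enorm_ge0 ?addr_ge0 ?distD//.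
  by rewrite -addrA lerD2l mulr2n mulrDl mul1r lerD ?PhiS.
(* The added 1 keeps [c] positive when [K] is a single point. *)
pose c := D + 1.
have c_gt0 : 0 < c by rewrite ltr_wpDl.
pose B := b * expR (2 * S * D).
have B_ge0 : 0 <= B by rewrite mulr_ge0 ?expR_ge0.
have p_le y x : K y -> p y x <= B * expR (c * Phi1 x).
  move=> Ky.
  apply: le_trans (ler_expR_dist_ln _ _ _ (p_gt0 y x) (p_gt0 y0 x)
    (log_e _ _ Ky)) _.
  rewrite -mulrA -expRD; apply: ler_pM; rewrite ?expR_ge0 ?p0b//.
  rewrite ler_expR /e /c; have := Phi1_ge0 x; nra.
(* A common lower bound of the weights [w y] for [y] in [K]. *)
pose h x := p y0 x * expR (- e x) * (q x `^ alpha) * expR (- io x).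
have me : measurable_fun setT e.
  by apply: measurable_funM => //; exact: measurable_funD.
have h_ge0 x : 0 <= h x.
  by rewrite !mulr_ge0 ?powR_ge0 ?expR_ge0.
have e_ge0 x : 0 <= e x by rewrite mulr_ge0// addr_ge0// mulr_ge0.
have inth : leb.-integrable setT (EFin \o h).
  apply: le_integrable (intw y0) => //.
    apply/measurable_EFinP; apply: measurable_funM => //.
    apply: measurable_funM => //; apply: measurable_funM => //.
    by apply: measurableT_comp => //; apply: measurableT_comp => //.
  move=> x _; rewrite /= lee_fin !ger0_norm//.
  rewrite /h /w /posterior_weight -/io ler_wpM2r ?expR_ge0//.
  rewrite ler_wpM2r ?powR_ge0// ler_piMr//.
  by rewrite -expR0 ler_expR oppr_le0.
have h_gt0 : 0 < \int[leb]_x h x.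
  apply: (Rintegral_gt0_density leb q) => // x hx0; apply/eqP.
  rewrite eq_le q_ge0 andbT leNgt; apply/negP => qx.
  suff : 0 < h x by rewrite hx0 ltxx.
  by rewrite !mulr_gt0 ?powR_gt0 ?expR_gt0.
have h_le_Z y : K y -> \int[leb]_x h x <= Z y.
  move=> Ky; apply: le_Rintegral => // x _.
  rewrite /h /w /posterior_weight -/io ler_wpM2r ?expR_ge0//.
  rewrite ler_wpM2r ?powR_ge0// expRN ler_pdivrMr ?expR_gt0//.
  by apply: ler_expR_dist_ln => //; rewrite distrC; exact: log_e.
pose k := B * Q * (1 + 2 * S).
have w_lip y1 y2 x : K y1 -> K y2 ->
    `|w y1 x - w y2 x| <= k * enorm (y1 - y2) * G c x.
  move=> Ky1 Ky2; rewrite /w /posterior_weight -/io -!mulrBl.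
  rewrite !normrM (ger0_norm (powR_ge0 _ _)) (ger0_norm (expR_ge0 _)).
  have p_lip : `|p y1 x - p y2 x| <=
      B * expR (c * Phi1 x) * ((1 + Phi1 x) * (1 + 2 * S) * enorm (y1 - y2)).
    apply: le_trans (ler_dist_ln _ _ _ _ _ (p_le _ x Ky1) (p_le _ x Ky2)) _ => //.
    apply: ler_wpM2l; first by rewrite mulr_ge0 ?expR_ge0.
    apply: le_trans (loglip _ _ _) _; rewrite ler_wpM2r ?enorm_ge0//.
    have := PhiS _ Ky1; have := PhiS _ Ky2; have := Phi1_ge0 x; nra.
  apply: (@le_trans _ _ (B * expR (c * Phi1 x) *
      ((1 + Phi1 x) * (1 + 2 * S) * enorm (y1 - y2)) * Q * expR (- io x))).
    rewrite ler_wpM2r ?expR_ge0// ler_pM ?powR_ge0//.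
  rewrite /G /k expRD le_eqVlt; apply/orP; left; apply/eqP; ring.
pose J := \int[leb]_x G c x.
have J_ge0 : 0 <= J by exact: Rintegral_ge0.
have k_ge0 : 0 <= k by rewrite !mulr_ge0// addr_ge0// mulr_ge0.
exists (2 / (\int[leb]_x h x) * (k * J)).
  by rewrite mulr_ge0 ?(mulr_ge0 k_ge0)// divr_ge0// ltW.
move=> y1 y2 Ky1 Ky2.
apply: le_trans (tv_norm_le_L1 leb (f y1) (f y2) _ _ (intf y1) (intf y2)
  (postP y1) (postP y2)) _.
have intfB : leb.-integrable setT (EFin \o (fun x => f y1 x - f y2 x)).
  exact: (integrableB measurableT (intf y1) (intf y2)).
have intwB : leb.-integrable setT (EFin \o (fun x => w y1 x - w y2 x)).
  exact: (integrableB measurableT (intw y1) (intw y2)).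
rewrite -[leLHS]fineK; last exact: integrable_fin_num (integrable_norm intfB).
rewrite lee_fin -/(Rintegral _ _ _).
apply: le_trans (L1_dist_normalize leb (w y1) (w y2) (intw y1) (intw y2)
  (w_ge0 y2) (Z_gt0 y1) (Z_gt0 y2)) _.
rewrite -[leRHS]mulrA; apply: ler_pM.
- by rewrite divr_ge0//; exact: ltW (Z_gt0 y1).
- exact: Rintegral_ge0.
- by rewrite ler_pM2l// lef_pV2 ?posrE//; [exact: h_le_Z|exact: Z_gt0].
rewrite mulrAC -RintegralZl//; last exact: intG.
apply: le_Rintegral => //.
- exact: integrable_norm intwB.
- exact: (integrableZl measurableT _ (intG c c_gt0)).
- by move=> x _; exact: w_lip.
Qed.
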